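(* Let $a<b$ be real numbers, let $\mathcal{X}=[a,b]$, and let $K$ be a bounded subset of $\mathbb{R}$. Let $f_0:\mathcal{X}\to K$ be a weakly increasing measurable function (the target function to be approximated), and let $\widehat f:\mathcal{X}\to K$ be another measurable function (an initial approximation to $f_0$). Let $\widehat f^*$ denote the increasing rearrangement of $\widehat f$ on $\mathcal{X}$. 1. For any $p\in[1,\infty]$, the rearrangement weakly reduces the estimation error: $$\left[\int_{\mathcal{X}} \left| \widehat f^*(x) - f_0(x) \right|^p dx \right]^{1/p} \leq \left[ \int_{\mathcal{X}} \left| \widehat f(x) - f_0(x) \right|^p dx \right]^{1/p}.$$ 2. Suppose that there exist regions $\mathcal{X}_0$ and $\mathcal{X}_0'$ in $\mathcal{X}$, each of measure greater than $\delta>0$, such that for all $x\in\mathcal{X}_0$ and $x'\in\mathcal{X}_0'$ we have (i) $x'>x$, (ii) $\widehat f(x)>\widehat f(x')+\epsilon$, and (iii) $f_0(x')>f_0(x)+\epsilon$, for some $\epsilon>0$. Then the gain in the quality of approximation is strict for $p\in(1,\infty)$. Namely, for any $p\in[1,\infty]$, $$\left[\int_{\mathcal{X}} \left| \widehat f^*(x) -f_0(x) \right|^p dx \right]^{1/p} \leq \left[ \int_{\mathcal{X}} \left| \widehat f(x) -f_0(x)\right|^p dx - \delta_{\mathcal{X}}\,\eta_p \right]^{1/p},$$ where $$\eta_p=\inf\left\{ |v-t'|^p+|v'-t|^p-|v-t|^p-|v'-t'|^p \right\},$$ with the infimum taken over all $v,v',t,t'$ in the set $K$ such that $v'\geq v+\epsilon$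 and $t'\geq t+\epsilon$; $\eta_p>0$ for $p\in(1,\infty)$; and $\delta_{\mathcal{X}}=\delta/(b-a)$.
   Context: Increasing rearrangement. For a measurable function $f:[0,1]\to K$ with $K\subset\mathbb{R}$ bounded, let $F_f(y)=\int_0^1 1\{f(u)\leq y\}\,du$, which is the distribution function of $f(X)$ when $X$ is uniform on $[0,1]$. The increasing rearrangement of $f$ is the quantile function $$f^*(x)=\inf\{y\in\mathbb{R}: F_f(y)\geq x\},\qquad x\in[0,1].$$ For a measurable $f:[a,b]\to K$ with $a<b$, put $\bar f(\bar x)=f(a+(b-a)\bar x)$ for $\bar x\in[0,1]$, let $\bar f^*$ be the rearrangement of $\bar f$ on $[0,1]$, and define $f^*(x)=\bar f^*\big((x-a)/(b-a)\big)$ for $x\in[a,b]$. Measure means Lebesgue measure, and expressions of the form $[\int_{\mathcal{X}}|g(x)|^p dx]^{1/p}$ denote $L_p$ norms, with the usual reading as the essential supremum of $|g|$ when $p=\infty$.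
   Formalization: The displayed bound in part 2 is false when b-a<1; for p<∞ it is proved with dx replaced by dx/(b-a) for all a<b, and as printed only when b-a≥1; for p=∞, where η_p is undefined, only the weak inequality without the gain term is claimed. *)

(* Defs.v *)
From HB Require Import structures.
From mathcomp Require Import all_boot all_order all_algebra.
From mathcomp Require Import all_classical all_reals all_analysis.
Set Implicit Arguments.
Unset Strict Implicit.
Unset Printing Implicit Defensive.
Import Order.TTheory GRing.Theory Num.Theory.
Import numFieldNormedType.Exports.
Local Open Scope classical_set_scope.
Local Open Scope ring_scope.
Local Open Scope ereal_scope.

(* Functions on [a, b] are represented by total functions on R, of which only
   the values on [a, b] are ever used. *)

Definition cdf01 (R : realType) (f : R -> R) (y : R) : \bar R :=
  \int[lebesgue_measure]_(u in `[0%R, 1%R]) (\1_[set t | (f t <= y)%R] u)%:E.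

(* Extended-real valued because the infimum is -oo at x = 0, as every y : R
   satisfies 0 <= cdf01 f y; it is finite on ]0, 1] for f bounded on [0, 1]. *)
Definition rearr01 (R : realType) (f : R -> R) (x : R) : \bar R :=
  ereal_inf [set y%:E | y in [set y : R | x%:E <= cdf01 f y]].

Definition rearr (R : realType) (a b : R) (f : R -> R) (x : R) : \bar R :=
  rearr01 (fun u => f (a + (b - a) * u)%R) ((x - a) / (b - a))%R.

Definition Lp_norm (R : realType) (a b : R) (p : \bar R) (g : R -> \bar R) :
    \bar R :=
  Lnorm (@lebesgue_measure R) p (g \_ `[a, b]).

Definition int_pow (R : realType) (a b p : R) (g : R -> \bar R) : \bar R :=
  \int[lebesgue_measure]_(x in `[a, b]) (`|g x| `^ p).

Definition avg_pow (R : realType) (a b p : R) (g : R -> \bar R) : \bar R :=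
  ((b - a)^-1)%:E * int_pow a b p g.

(* [inf] is the real infimum; it has its usual meaning here whenever K is
   bounded and some v, v', t, t' in K satisfy the constraints. *)
Definition eta_gain (R : realType) (K : set R) (eps p : R) : R :=
  inf [set z : R | exists v v' t t' : R,
    [/\ K v, K v', K t & K t'] /\ (v + eps <= v')%R /\ (t + eps <= t')%R /\
    z = (`|v - t'| `^ p + `|v' - t| `^ p - `|v - t| `^ p - `|v' - t'| `^ p)%R].

(* Main.v *)
(* The error is the integral of a cost c(v, t) = phi (v - t) with phi convex, so
   c(v', t) - c(v, t) is nonincreasing in t for v <= v'. Rounding v up to a grid
   y_0 < ... < y_N turns c(f, f0) into a constant plus the sum over k of
   1{f > y_k} d_k, where d_k = c(y_{k+1}, f0) - c(y_k, f0) is nonincreasing in x.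
   Rearranging f replaces {f > y_k} by the interval ]s_k, b] of equal measure, and
   (1{f > y_k} - 1{x > s_k}) (d_k(x) - d_k(s_k)) is pointwise nonnegative with the
   same integral as (1{f > y_k} - 1{x > s_k}) d_k. For x in X0 and x' in X0', the
   sum over k of its values at x and x' is at least the cross difference
   c(f x, f0 x) + c(f x', f0 x') - c(f x, f0 x') - c(f x', f0 x), which is at least
   eta_p up to the rounding error: this is the gain. Taking phi u = |u|^p settles
   finite p, and phi u = max(|u| - E, 0), with E the essential supremum of the
   initial error, settles p = oo. *)
Require Import Defs.
From HB Require Import structures.
From mathcomp Require Import all_boot all_order all_algebra.
From mathcomp Require Import all_classical all_reals all_analysis.
From mathcomp Require Import measurable_realfun ess_sup_inf.
From mathcomp Require Import ring lra.
Set Implicit Arguments.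
Unset Strict Implicit.
Unset Printing Implicit Defensive.
Import Order.TTheory GRing.Theory Num.Theory.
Import numFieldNormedType.Exports.
Local Open Scope classical_set_scope.
Local Open Scope ring_scope.

(** * Convex functions on the line *)

(** The chord inequality with its denominator [z - x] cleared, so that coinciding points are
    allowed. *)
Definition convex_fun (R : realType) (phi : R -> R) :=
  forall x y z, x <= y -> y <= z ->
    phi y * (z - x) <= phi x * (z - y) + phi z * (y - x).

(** Both [t] and [s + h] lie between [s] and [t + h], with complementary weights; the two chord
    inequalities add up to the claim multiplied by [t + h - s]. *)
Lemma convex_fun_increment (R : realType) (phi : R -> R) (s t h : R) :
  convex_fun phi -> s <= t -> 0 <= h ->
  phi (s + h) - phi s <= phi (t + h) - phi t.
Proof.
move=> cphi st h0.
have [E|D0] := eqVneq (t + h) s.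
  by have -> : t = s by lra.
have Dp : 0 < t + h - s by rewrite lt_neqAle subr_ge0 eq_sym subr_eq0 D0/=; lra.
have := cphi s (s + h) (t + h); have := cphi s t (t + h).
move=> /(_ st) H1 /(_ _ _) H2.
have {}H1 := H1 ltac:(lra); have {}H2 := H2 ltac:(lra) ltac:(lra).
rewrite -subr_ge0 -(pmulr_lge0 _ Dp); nra.
Qed.

(** Slopes on [[-B, B]] are controlled by chords ending at [B + 1] or [- (B + 1)]. These points are
    at distance at least 1 from the interval, and [phi] is nonnegative, so the values of [phi] there
    bound the slopes. *)
Lemma convex_fun_lipschitz (R : realType) (phi : R -> R) (B : R) :
  convex_fun phi -> (forall s, 0 <= phi s) ->
  exists2 L, 0 <= L & forall s t, `|s| <= B -> `|t| <= B ->
    `|phi s - phi t| <= L * `|s - t|.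
Proof.
move=> cphi phi0; exists (phi (B + 1) + phi (- (B + 1))); first by rewrite addr_ge0.
suff H s t : `|s| <= B -> `|t| <= B -> s <= t ->
    `|phi s - phi t| <= (phi (B + 1) + phi (- (B + 1))) * (t - s).
  move=> s t sB tB; have [st|ts] := leP s t.
    by rewrite [`|s - t|]distrC [`|t - s|]ger0_norm ?subr_ge0// H.
  by rewrite distrC [`|s - t|]gtr0_norm ?subr_gt0// H// ltW.
rewrite !ler_norml => /andP[s1 s2] /andP[t1 t2] st.
have H1 := cphi s t (B + 1) st ltac:(lra).
have H2 := cphi (- (B + 1)) s t ltac:(lra) st.
have P1 := phi0 (B + 1); have P2 := phi0 (- (B + 1)).
have P3 := phi0 s; have P4 := phi0 t.
apply/andP; split.
- have [?|?] := leP (phi t) (phi s); first by nra.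
  have : (phi t - phi s) * (B + 1 - s) <= phi (B + 1) * (t - s) by nra.
  nra.
- have [?|?] := leP (phi s) (phi t); first by nra.
  have : (phi s - phi t) * (B + 1 + t) <= phi (- (B + 1)) * (t - s) by nra.
  nra.
Qed.

Lemma convex_fun_continuous (R : realType) (phi : R -> R) :
  convex_fun phi -> (forall s, 0 <= phi s) -> continuous phi.
Proof.
move=> cphi phi0 x.
have [L L0 HL] := convex_fun_lipschitz (`|x| + 1) cphi phi0.
apply/cvgrPdist_le => e e0.
near=> t.
have xt1 : `|x - t| <= 1 by near: t; apply: cvgr_dist_le => //; exact: cvg_id.
have xt2 : `|x - t| <= e / (L + 1).
  near: t; apply: cvgr_dist_le; first exact: cvg_id.
  by rewrite divr_gt0// ltr_wpDl.
have tB : `|t| <= `|x| + 1.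
  by rewrite -[t](subKr x) (le_trans (ler_normB _ _))// lerD2l.
apply: (le_trans (HL x t _ tB)); first by rewrite lerDl.
rewrite ler_pdivlMr in xt2; last by rewrite ltr_wpDl.
apply: le_trans xt2; rewrite mulrC ler_wpM2l//; lra.
Unshelve. all: by end_near. Qed.

(** The triangle inequality bounds [|y|] by the weighted mean of [|x|] and [|z|]; the power is
    increasing and convex on the half line. *)
Lemma convex_fun_norm_powR (R : realType) (p : R) :
  1 <= p -> convex_fun (fun s : R => `|s| `^ p).
Proof.
move=> p1 x y z xy yz.
have p0 : 0 <= p by lra.
have [zx|zx] := leP z x.
  have -> : z = x by lra.
  have -> : y = x by lra.
  by lra.
have w0 : 0 <= (z - y) / (z - x) by rewrite divr_ge0//; lra.
have w1 : (z - y) / (z - x) <= 1 by rewrite ler_pdivrMr ?mul1r; lra.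
pose t : {i01 R} := Itv01 w0 w1.
have := @convex_powR R p p1 t `|x| `|z|.
rewrite !inE/= !in_itv/= !andbT !normr_ge0 => /(_ isT isT).
rewrite !convRE/= /unstable.onem => H.
have zx0 : z - x != 0 by rewrite gt_eqF// subr_gt0.
have yE : y = (z - y) / (z - x) * x + (1 - (z - y) / (z - x)) * z by field.
have yle : `|y| <= (z - y) / (z - x) * `|x| + (1 - (z - y) / (z - x)) * `|z|.
  rewrite {1}yE (le_trans (ler_normD _ _))//.
  rewrite (normrM _ x) (normrM _ z) (ger0_norm w0).
  by rewrite (@ger0_norm _ (1 - _)) ?subr_ge0.
have {}H : `|y| `^ p <= (z - y) / (z - x) * `|x| `^ p
                        + (1 - (z - y) / (z - x)) * `|z| `^ p.
  apply: le_trans H; apply: ge0_ler_powR => //; rewrite nnegrE//.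
  by rewrite (le_trans _ yle).
have -> : `|x| `^ p * (z - y) + `|z| `^ p * (y - x) =
   ((z - y) / (z - x) * `|x| `^ p + (1 - (z - y) / (z - x)) * `|z| `^ p) * (z - x).
  by field.
by rewrite ler_wpM2r// subr_ge0 ltW.
Qed.

Lemma powR_midpoint_lt (R : realType) (p u w : R) :
  1 < p -> 0 <= u -> u < w ->
  2 * ((u + w) / 2) `^ p < u `^ p + w `^ p.
Proof.
move=> p1 u0 uw; set m := (u + w) / 2.
have cont (x y : R) : 0 <= x -> {within `[x, y], continuous (@powR R ^~ p)}.
  move=> x0; apply: (@subspace_eq_continuous _ _ _ (fun s : R => `|s| `^ p)).
    move=> s; rewrite inE/= in_itv/= => /andP[xs _] /=.
    by rewrite ger0_norm// (le_trans x0).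
  apply: continuous_subspaceT; apply: convex_fun_continuous.
    by apply: convex_fun_norm_powR; exact: ltW.
  by move=> s; exact: powR_ge0.
have um : u < m by rewrite /m; lra.
have mw : m < w by rewrite /m; lra.
have der (x y : R) : 0 <= x -> forall t, t \in `]x, y[%R ->
    is_derive t 1 (@powR R ^~ p) (p * t `^ (p - 1)).
  move=> x0 t; rewrite in_itv/= => /andP[xt _]; apply: is_derive1_powR; lra.
have [c1 + E1] := MVT um (der u m u0) (cont u m u0).
have m0 : 0 <= m by lra.
have [c2 + E2] := MVT mw (der m w m0) (cont m w m0).
rewrite !in_itv/= => /andP[? ?] /andP[? ?].
have c12 : c1 `^ (p - 1) < c2 `^ (p - 1).
  by apply: gt0_ltr_powR; rewrite ?nnegrE; lra.
have Em : m - u = w - m by rewrite /m; lra.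
rewrite Em in E1.
have : p * c1 `^ (p - 1) * (w - m) < p * c2 `^ (p - 1) * (w - m).
  by rewrite ltr_pM2r ?subr_gt0// ltr_pM2l//; lra.
rewrite -E1 -E2; lra.
Qed.

Lemma norm_powR_midpoint_lt (R : realType) (p s e : R) :
  1 < p -> 0 < e ->
  2 * `|s + e| `^ p < `|s| `^ p + `|s + 2 * e| `^ p.
Proof.
move=> p1 e0.
(* The reflection of [s] to [- (s + 2 * e)] exchanges the two outer points and keeps the norm of the
   midpoint. *)
wlog lt_sw : s / `|s| <= `|s + 2 * e|.
  move=> H; have [/H//|lt] := leP `|s| `|s + 2 * e|.
  have := H (- (s + 2 * e)).
  rewrite normrN (_ : - (s + 2 * e) + 2 * e = - s); last by ring.
  rewrite normrN => /(_ (ltW lt)).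
  rewrite (_ : - (s + 2 * e) + e = - (s + e)); last by ring.
  by rewrite normrN [X in _ < X -> _]addrC.
move: lt_sw; rewrite le_eqVlt => /predU1P[E|lt].
  (* Equal norms at distinct points force opposite points: the midpoint is 0 and the left side
     vanishes. *)
  have se : s + e = 0.
    by move: E; case: (ger0P s); case: (ger0P (s + 2 * e)); lra.
  have p0 : p != 0 by rewrite gt_eqF//; lra.
  have s0 : s != 0 by apply/eqP; lra.
  by rewrite se normr0 powR0// mulr0 ltr_wpDr ?powR_ge0// powR_gt0// normr_gt0.
apply: le_lt_trans (powR_midpoint_lt p1 _ lt) => //.
rewrite ler_pM2l//; apply: ge0_ler_powR; rewrite ?nnegrE ?divr_ge0//; first lra.
have -> : s + e = (s + (s + 2 * e)) / 2 by field.
by rewrite normrM (@gtr0_norm _ 2^-1)// ler_pM2r// ler_normD.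
Qed.

(** The second difference is continuous and positive, hence has a positive minimum on the compact
    interval [[-B, B]]. This uniform bound makes the infimum defining the gain positive. *)
Lemma norm_powR_gap (R : realType) (p e B : R) :
  1 < p -> 0 < e -> 0 <= B ->
  exists2 g, 0 < g & forall s, `|s| <= B ->
    g <= `|s| `^ p + `|s + 2 * e| `^ p - 2 * `|s + e| `^ p.
Proof.
move=> p1 e0 B0.
have cont : continuous (fun s : R => `|s| `^ p).
  apply: convex_fun_continuous; first by apply: convex_fun_norm_powR; exact: ltW.
  by move=> s; exact: powR_ge0.
have contD (c : R) : continuous (fun s : R => `|s + c| `^ p).
  move=> s; apply: (@continuous_comp _ _ _ (fun s : R => s + c)
    (fun s : R => `|s| `^ p)); last exact: cont.
  by apply: cvgD; [exact: cvg_id|exact: cvg_cst].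
pose g (s : R) := `|s| `^ p + `|s + 2 * e| `^ p - 2 * `|s + e| `^ p.
have gc : continuous g.
  move=> s; apply: cvgB; first by apply: cvgD; [exact: cont|exact: contD].
  by apply: cvgM; [exact: cvg_cst|exact: contD].
have BB : - B <= B by lra.
have [c _ Hc] := EVT_min BB (continuous_subspaceT gc).
exists (g c); first by rewrite subr_gt0 norm_powR_midpoint_lt.
by move=> s sB; apply: Hc; rewrite in_itv/= -ler_norml.
Qed.

(** This cost vanishes exactly where [|s| <= E], so a zero integral expresses an essential bound by
    [E]. Where it is positive at [y], it equals [|y| - E] and the triangle inequality applies. *)
Lemma convex_fun_dead_zone (R : realType) (E : R) :
  convex_fun (fun s : R => Num.max (`|s| - E) 0).
Proof.
move=> x y z xy yz; set fx := Num.max (`|x| - E) 0; set fz := Num.max (`|z| - E) 0.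
have fx0 : 0 <= fx by rewrite le_max lexx orbT.
have fz0 : 0 <= fz by rewrite le_max lexx orbT.
have fx1 : `|x| - E <= fx by rewrite le_max lexx.
have fz1 : `|z| - E <= fz by rewrite le_max lexx.
have [fy|fy] := leP (`|y| - E) 0.
  by rewrite mul0r addr_ge0// mulr_ge0// subr_ge0.
have yE : `|y| * (z - x) <= `|x| * (z - y) + `|z| * (y - x).
  have z0 : 0 <= z - x by lra.
  rewrite -{1}(ger0_norm z0) -normrM.
  have -> : y * (z - x) = x * (z - y) + z * (y - x) by ring.
  rewrite (le_trans (ler_normD _ _))// !normrM.
  by rewrite (@ger0_norm _ (z - y)) ?subr_ge0// (@ger0_norm _ (y - x)) ?subr_ge0.
nra.
Qed.

(** * The gain of a quantile function *)

(** The sum telescopes up to the index where [b] switches off. At [y k = u] the boolean is left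
    free, since stopping there or one step later both round [u] up by at most [h]. *)
Lemma telescope_threshold (R : realDomainType) (y : nat -> R) (h u : R)
    (b : nat -> bool) (Q : nat -> R) (N : nat) :
  (forall k, y k.+1 = y k + h) -> 0 < h -> y 0%N <= u + h -> u <= y N ->
  (forall k, (k < N)%N -> y k < u -> b k) ->
  (forall k, (k < N)%N -> u < y k -> ~~ b k) ->
  exists2 j, (j <= N)%N /\ u <= y j <= u + h &
    Q 0%N + \sum_(k < N) (b k)%:R * (Q k.+1 - Q k) = Q j.
Proof.
move=> yS h0 y0u uyN bT bF.
have yI k l : (k < l)%N -> y k < y l.
  elim: l => // l IH; rewrite ltnS leq_eqVlt => /predU1P[->|/IH]; rewrite yS; lra.
(* Invariant: either every increment so far was taken and [u] may still lie ahead, or the sum is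
   frozen at some [Q j]. *)
suff H n : (n <= N)%N ->
    (y n <= u + h /\ Q 0%N + \sum_(k < n) (b k)%:R * (Q k.+1 - Q k) = Q n) \/
    exists2 j, (j < n)%N /\ u <= y j <= u + h &
      Q 0%N + \sum_(k < n) (b k)%:R * (Q k.+1 - Q k) = Q j.
  have [[yNu ->]|[j [jN uj] ->]] := H N (leqnn N).
    by exists N => //; rewrite leqnn uyN yNu.
  by exists j => //; rewrite ltnW.
elim: n => [_|n IH nN]; first by left; rewrite big_ord0 addr0.
have [[ynu E]|[j [jn /andP[uj ju]] E]] := IH (ltnW nN); rewrite big_ord_recr/= addrA E.
  case bn : (b n); last first.
    right; exists n; last by rewrite mul0r addr0.
    by rewrite ynu andbT; split=> //; rewrite leNgt; apply/negP => /(bT _ nN); rewrite bn.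
  left; split; last by rewrite mul1r subrKC.
  by rewrite yS lerD2r leNgt; apply/negP => /(bF _ nN); rewrite bn.
right; exists j; first by rewrite uj ju (ltn_trans jn).
by rewrite (negbTE (bF _ nN _)) ?mul0r ?addr0// (le_lt_trans uj)// yI.
Qed.

Lemma Rintegral_sum d (T : measurableType d) (R : realType)
    (mu : {measure set T -> \bar R}) (D : set T) (F : nat -> T -> R) (n : nat) :
  measurable D -> (forall k, mu.-integrable D (EFin \o F k)) ->
  mu.-integrable D (EFin \o (fun x => \sum_(k < n) F k x)) /\
  \int[mu]_(x in D) (\sum_(k < n) F k x) = \sum_(k < n) \int[mu]_(x in D) F k x.
Proof.
move=> mD iF; elim: n => [|n [IH1 IH2]].
  have E : (fun x => \sum_(k < 0) F k x) = cst (0 : R).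
    by apply/funext => x; rewrite big_ord0.
  by rewrite E big_ord0 Rintegral_cst// mul0r; split => //; exact: integrable0.
have E : (fun x => \sum_(k < n.+1) F k x) = (fun x => (\sum_(k < n) F k x) + F n x).
  by apply/funext => x; rewrite big_ord_recr.
rewrite E; split.
  have -> : EFin \o (fun x => \sum_(k < n) F k x + F n x) =
    (EFin \o (fun x => (\sum_(k < n) F k x))) \+ (EFin \o F n) by [].
  exact: integrableD.
by rewrite RintegralD// IH2 big_ord_recr.
Qed.

(** Turns a lower bound on pairs of values into one on the integral: [X] and [X'] are disjoint, and
    each contributes at least [delta] times a lower bound of [H] on it. *)
Lemma Rintegral_ge_pair d (T : measurableType d) (R : realType)
    (mu : {measure set T -> \bar R}) (D X X' : set T) (H : T -> R) (c delta : R) :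
  measurable D -> measurable X -> measurable X' ->
  X `<=` D -> X' `<=` D -> X `&` X' = set0 ->
  mu.-integrable D (EFin \o H) -> (mu D < +oo)%E ->
  (forall x, D x -> 0 <= H x) ->
  (forall x x', X x -> X' x' -> c <= H x + H x') ->
  0 <= delta -> (delta%:E <= mu X)%E -> (delta%:E <= mu X')%E ->
  delta * c <= \int[mu]_(x in D) H x.
Proof.
move=> mD mX mX' XD XD' XX' iH muD H0 HX d0 dX dX'.
have int0 : 0 <= \int[mu]_(x in D) H x by exact: Rintegral_ge0.
have [->|dn0] := eqVneq delta 0; first by rewrite mul0r.
have dp : 0 < delta by rewrite lt_neqAle eq_sym dn0.
have [c0|c0] := leP c 0; first by rewrite (le_trans _ int0)// mulr_ge0_le0.
have ne (Y : set T) : (delta%:E <= mu Y)%E -> Y !=set0.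
  move=> dY; apply/set0P; apply: contraTneq dY => ->.
  by rewrite measure0 -ltNge lte_fin.
have [x1 X1] := ne X dX; have [x1' X1'] := ne X' dX'.
have fin (Y : set T) : measurable Y -> Y `<=` D -> mu Y \is a fin_num.
  move=> mY YD; rewrite ge0_fin_numE//; apply: le_lt_trans muD.
  by apply: le_measure; rewrite ?inE.
(* The hypothesis passes to the infima, inf_X H + inf_X' H >= c, so no product
   measure is needed. *)
pose m := inf (H @` X); pose m' := Num.max (c - m) 0.
have lb : has_lbound (H @` X) by exists 0 => _ [x /XD/H0 Hx <-].
have mle x : X x -> m <= H x by move=> Xx; apply: ge_inf => //; exists x.
have m0 : 0 <= m.
  by apply: lb_le_inf; [exists (H x1), x1|move=> _ [x /XD/H0 ? <-]].
have mle' x : X' x -> m' <= H x.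
  move=> Xx; rewrite ge_max H0 ?andbT//; last exact: XD'.
  rewrite lerBlDr -lerBlDl; apply: lb_le_inf; first by exists (H x1), x1.
  by move=> _ [z Xz <-]; have := HX z x Xz Xx; lra.
(* Since [mu Y] may exceed [delta], the bound [r] has to be nonnegative; this is why [m'] is cut off
   at 0. *)
have part (Y : set T) (r : R) : measurable Y -> Y `<=` D -> 0 <= r ->
    (delta%:E <= mu Y)%E -> (forall x, Y x -> r <= H x) ->
    delta * r <= \int[mu]_(x in Y) H x.
  move=> mY YD r0 dY rH.
  apply: (@le_trans _ _ (\int[mu]_(x in Y) r)).
    rewrite Rintegral_cst// mulrC ler_wpM2l//.
    by rewrite -lee_fin fineK// fin.
  apply: le_Rintegral => //; last exact: integrableS iH.
  apply/integrableP; split; first exact: measurable_cst.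
  rewrite integral_cst// lte_mul_pinfty//.
  by rewrite (le_lt_trans _ muD)// le_measure ?inE.
have XXD : X `|` X' `<=` D by rewrite subUset.
apply: (@le_trans _ _ (\int[mu]_(x in X `|` X') H x)).
  rewrite Rintegral_setU//; first last.
  - by apply/disj_setPS; rewrite XX'.
  - by apply: integrableS iH => //; exact: measurableU.
  apply: (@le_trans _ _ (delta * m + delta * m')).
    rewrite -mulrDr ler_wpM2l//.
    by have : c - m <= m' by [rewrite le_max lexx]; lra.
  by rewrite lerD// part// le_max lexx orbT.
rewrite /Rintegral fine_le//.
- apply: integrable_fin_num; first exact: measurableU.
  by apply: integrableS iH => //; exact: measurableU.
- exact: integrable_fin_num.
- apply: ge0_subset_integral => //; first exact: measurableU.
  by case/integrableP: iH.
Qed.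

Lemma bounded_integrable d (T : measurableType d) (R : realType)
    (mu : {measure set T -> \bar R}) (D : set T) (f : T -> R) (C : R) :
  measurable D -> (mu D < +oo)%E -> measurable_fun D f ->
  (forall x, D x -> `|f x| <= C) -> mu.-integrable D (EFin \o f).
Proof.
move=> mD Doo mf fC; apply: measurable_bounded_integrable => //.
exists C; split; first exact: num_real.
by move=> M CM x Dx; exact: le_trans (fC x Dx) (ltW CM).
Qed.

Lemma convex_comp_integrable d (T : measurableType d) (R : realType)
    (mu : {measure set T -> \bar R}) (D : set T) (phi : R -> R) (g : T -> R)
    (B : R) :
  convex_fun phi -> (forall s, 0 <= phi s) ->
  measurable D -> (mu D < +oo)%E -> measurable_fun D g ->
  (forall x, D x -> `|g x| <= B) ->
  mu.-integrable D (EFin \o (phi \o g)).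
Proof.
move=> cphi phi0 mD Doo mg gB.
have [L L0 HL] := convex_fun_lipschitz B cphi phi0.
apply: (@bounded_integrable _ _ _ _ _ _ (phi 0 + L * B)) => //.
  apply: measurableT_comp => //; apply: continuous_measurable_fun.
  exact: convex_fun_continuous.
move=> x Dx /=; rewrite ger0_norm//.
have B0 : 0 <= B by rewrite (le_trans _ (gB x Dx)).
have := HL (g x) 0 (gB x Dx); rewrite normr0 subr0 => /(_ B0) H.
have : phi (g x) - phi 0 <= L * `|g x| by rewrite (le_trans (ler_norm _)).
have : L * `|g x| <= L * B by rewrite ler_wpM2l// gB.
lra.
Qed.

(** * Comparison of the two errors on a grid of levels *)

Section discretized.
(** [G] stands for the increasing rearrangement of [F], and [s y] for the point of [[a, b]] at which
    the rearranged values pass the level [y]. *)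
Variables (R : realType) (a b m M : R) (phi F G f0 s : R -> R).
Local Notation D := (`[a, b]%classic : set R).
Local Notation mu := (@lebesgue_measure R).
Hypothesis hab : a < b.
Hypothesis hmM : m < M.
Hypothesis cphi : convex_fun phi.
Hypothesis phi0 : forall u, 0 <= phi u.
Hypothesis F_meas : measurable_fun D F.
Hypothesis G_meas : measurable_fun D G.
Hypothesis f0_meas : measurable_fun D f0.
Hypothesis F_itv : forall x, D x -> m <= F x <= M.
Hypothesis G_itv : forall x, D x -> m <= G x <= M.
Hypothesis f0_itv : forall x, D x -> m <= f0 x <= M.
Hypothesis f0_mono : forall x y, D x -> D y -> x <= y -> f0 x <= f0 y.
Hypothesis s_itv : forall y, D (s y).
Hypothesis s_cdf : forall y, m <= y <= M ->
  mu (D `&` [set x | F x <= y]) = (s y - a)%:E.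
(* The equivalence G x <= y <-> x <= s y would need the right continuity of the
   distribution function. *)
Hypothesis G_s : forall x y, D x -> m <= y <= M ->
  (G x < y -> x <= s y) /\ (x <= s y -> G x <= y).

(** Each rounding to the grid costs at most [L * h], with [h = (M - m) / N]. The cross difference
    involves four roundings, the comparison of [F] with [G] at a point two. *)
Lemma discretized_gain (L : R) (N : nat) (X0 X0' : set R) (delta eta : R) :
  (0 < N)%N -> 0 <= L ->
  (forall u v, `|u| <= M - m -> `|v| <= M - m ->
    `|phi u - phi v| <= L * `|u - v|) ->
  measurable X0 -> measurable X0' -> X0 `<=` D -> X0' `<=` D ->
  (forall x x', X0 x -> X0' x' -> [/\ x < x', F x' <= F x &
    eta <= phi (F x - f0 x) - phi (F x - f0 x') - phi (F x' - f0 x)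
           + phi (F x' - f0 x')]) ->
  0 <= delta -> (delta%:E <= mu X0)%E -> (delta%:E <= mu X0')%E ->
  delta * (eta - 4 * (L * ((M - m) / N%:R)))
    <= \int[mu]_(x in D) phi (F x - f0 x) - \int[mu]_(x in D) phi (G x - f0 x)
       + 2 * (L * ((M - m) / N%:R)) * (b - a).
Proof.
move=> N0 L0 HL mX mX' XD XD' HX d0 dX dX'.
set h := (M - m) / N%:R.
have h0 : 0 < h by rewrite divr_gt0 ?subr_gt0// ltr0n.
pose y (k : nat) := m + k%:R * h.
have yS k : y k.+1 = y k + h by rewrite /y -natr1; ring.
have y0 : y 0%N = m by rewrite /y mul0r addr0.
have yN : y N = M by rewrite /y /h; field; rewrite gt_eqF// ltr0n.
have ymono k l : (k <= l)%N -> y k <= y l.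
  by move=> kl; rewrite lerD2l ler_wpM2r ?ler_nat// ltW.
have yitv k : (k <= N)%N -> m <= y k <= M by move=> kN; rewrite -y0 -yN !ymono.
have mD : measurable (D : set (measurableTypeR R)) by [].
have Doo : (mu D < +oo)%E by rewrite lebesgue_measure_itv/= lte_fin hab ltry.
have muD : mu D = (b - a)%:E by rewrite lebesgue_measure_itv/= lte_fin hab.
pose A k : set R := D `&` [set x | y k < F x].
pose B k : set R := `]s (y k), b]%classic.
have mA k : measurable (A k).
  rewrite /A (_ : [set x | _] = F @^-1` `]y k, +oo[%classic).
    by apply: F_meas => //; exact: measurable_itv.
  by apply/seteqP; split=> x /=; rewrite in_itv/= andbT.
have mB k : measurable (B k) by exact: measurable_itv.
(* Equimeasurability of [F] and its rearrangement at the level [y k]. *)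
have muAB k : (k < N)%N -> mu (A k) = mu (B k `&` D).
  move=> kN; have [sa sb] : a <= s (y k) /\ s (y k) <= b.
    by have := s_itv (y k); rewrite /= in_itv/= => /andP[].
  have BD : B k `&` D = B k.
    apply/setIidPl => x; rewrite /B/= !in_itv/= => /andP[/ltW sx xb].
    by rewrite (le_trans sa sx) xb.
  rewrite BD lebesgue_measure_itv/= lte_fin.
  have -> : A k = D `\` (D `&` [set x | F x <= y k]).
    apply/seteqP; split=> x /=.
      by move=> [Dx yx]; split => //; rewrite not_andP; right; apply/negP; rewrite -ltNge.
    by move=> [Dx] /not_andP[//|/negP]; rewrite -ltNge.
  have mle : measurable (D `&` [set x | F x <= y k]).
    rewrite (_ : [set x | _] = F @^-1` `]-oo, y k]%classic).
      by apply: F_meas => //; exact: measurable_itv.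
    by apply/seteqP; split=> x /=; rewrite in_itv/=.
  rewrite measureD//= setIA setIid s_cdf ?yitv// 1?ltnW//.
  rewrite -[LHS]/(mu D - _)%E muD.
  have [_|bs] := ltP; first by rewrite -EFinB; congr EFin; ring.
  by rewrite -EFinB; congr EFin; lra.
pose inc (k : nat) (t : R) := phi (y k.+1 - t) - phi (y k - t).
(* Convexity enters here: raising the approximation by one grid step costs less when the target is
   larger. *)
have inc_le k t t' : t <= t' -> inc k t' <= inc k t.
  move=> tt'; have := @convex_fun_increment _ phi (y k - t') (y k - t) h cphi.
  rewrite lerD2l lerN2 => /(_ tt' (ltW h0)).
  by rewrite /inc yS; congr (phi _ - _ <= phi _ - _); ring.
pose theta k := inc k (f0 (s (y k))).
pose ind (E : set R) (x : R) : R := (x \in E)%:R.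
(* [H] is the difference of the rounded costs with each increment centred at its value [theta k] at
   the cut; [W] collects the centring terms and will have integral zero. *)
pose H x := \sum_(k < N) (ind (A k) x - ind (B k) x) * (inc k (f0 x) - theta k).
pose W x := \sum_(k < N) theta k * (ind (A k) x - ind (B k) x).
have inA k (x : R) : D x -> (x \in A k) = (y k < F x).
  move=> Dx; apply/idP/idP; first by rewrite inE => -[].
  by move=> yx; rewrite inE; split.
have inB k (x : R) : D x -> (x \in B k) = (s (y k) < x).
  move=> Dx; have xb : x <= b by move: Dx; rewrite /= in_itv/= => /andP[].
  by rewrite mem_setE in_itv/= xb andbT.
(* As [f0] is increasing, the centred increment changes sign at [s (y k)], exactly where [B k]
   begins. *)
have thetaB k (x : R) : D x -> if x \in B k then inc k (f0 x) <= theta k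
                         else theta k <= inc k (f0 x).
  move=> Dx; rewrite inB//; have [sx|xs] := ltP; apply: inc_le; apply: f0_mono => //.
  exact: ltW.
have H0 x : D x -> 0 <= H x.
  move=> Dx; apply: sumr_ge0 => k _; have := thetaB k x Dx.
  by rewrite /ind; case: (x \in A k); case: (x \in B k) => /= ?; nra.
(* The target value [t] is kept independent of [x], because the cross difference pairs [F x] with
   [f0 x']. *)
pose TF x t := phi (y 0%N - t) + \sum_(k < N) ind (A k) x * inc k t.
pose TG x t := phi (y 0%N - t) + \sum_(k < N) ind (B k) x * inc k t.
have tele (g : R -> R) (c : nat -> R -> bool) x t :
    D x -> m <= g x <= M -> m <= t <= M ->
    (forall k, (k < N)%N -> y k < g x -> c k x) ->
    (forall k, (k < N)%N -> g x < y k -> ~~ c k x) ->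
    `|phi (y 0%N - t) + \sum_(k < N) (c k x)%:R * inc k t - phi (g x - t)| <= L * h.
  move=> Dx /andP[mg gM] /andP[mt tM] cT cF.
  have [||j [jN /andP[gy yg]] E] := @telescope_threshold R y h (g x) (c ^~ x)
    (fun k => phi (y k - t)) N yS h0 _ _ cT cF.
  - by rewrite y0; lra.
  - by rewrite yN.
  rewrite E; have /andP[? ?] := yitv j jN.
  apply: le_trans (HL _ _ _ _) _; try by rewrite ler_norml; apply/andP; split; lra.
  rewrite ler_wpM2l// ler_norml; apply/andP; split; lra.
have TFE x t : D x -> m <= t <= M -> `|TF x t - phi (F x - t)| <= L * h.
  move=> Dx tm; apply: (tele F (fun k x => x \in A k)) => //; first exact: F_itv.
    by move=> k _; rewrite inA.
  by move=> k _; rewrite inA// -leNgt; exact: ltW.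
(* When [G x = y k], membership in [B k] is undetermined; the free boolean of [telescope_threshold]
   absorbs this case. *)
have TGE x t : D x -> m <= t <= M -> `|TG x t - phi (G x - t)| <= L * h.
  move=> Dx tm; apply: (tele G (fun k x => x \in B k)) => //; first exact: G_itv.
    move=> k kN yG; rewrite inB// ltNge; apply/negP => xs.
    by have [_ /(_ xs)] := G_s Dx (yitv k (ltnW kN)); rewrite leNgt yG.
  move=> k kN yG; rewrite inB// -leNgt.
  by have [/(_ yG)] := G_s Dx (yitv k (ltnW kN)).
have Hle x : D x ->
    H x <= phi (F x - f0 x) - phi (G x - f0 x) + (2 * (L * h) - W x).
  move=> Dx; have := TFE x (f0 x) Dx (f0_itv Dx); have := TGE x (f0 x) Dx (f0_itv Dx).
  rewrite !ler_norml => /andP[? ?] /andP[? ?].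
  suff : H x = TF x (f0 x) - TG x (f0 x) - W x by lra.
  rewrite /TF /TG /H /W opprD addrACA subrr add0r -!sumrB.
  by apply: eq_bigr => k _; ring.
have HX' x x' : X0 x -> X0' x' -> eta - 4 * (L * h) <= H x + H x'.
  move=> Xx Xx'; have [xx' FF eH] := HX x x' Xx Xx'.
  have Dx := XD x Xx; have Dx' := XD' x' Xx'.
  apply: (@le_trans _ _ (TF x (f0 x) - TF x (f0 x') - TF x' (f0 x) + TF x' (f0 x'))).
    have := TFE x (f0 x) Dx (f0_itv Dx); have := TFE x (f0 x') Dx (f0_itv Dx').
    have := TFE x' (f0 x) Dx' (f0_itv Dx); have := TFE x' (f0 x') Dx' (f0_itv Dx').
    rewrite !ler_norml => /andP[? ?] /andP[? ?] /andP[? ?] /andP[? ?]; lra.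
  have -> : TF x (f0 x) - TF x (f0 x') - TF x' (f0 x) + TF x' (f0 x') =
     \sum_(k < N) (ind (A k) x - ind (A k) x') * (inc k (f0 x) - inc k (f0 x')).
    rewrite /TF.
    transitivity (\sum_(k < N) ind (A k) x * inc k (f0 x)
      - \sum_(k < N) ind (A k) x * inc k (f0 x')
      - \sum_(k < N) ind (A k) x' * inc k (f0 x)
      + \sum_(k < N) ind (A k) x' * inc k (f0 x')); first by ring.
    by rewrite -!sumrB -big_split/=; apply: eq_bigr => k _; ring.
  (* The bound holds term by term. The orders [F x' <= F x] and [x < x'] leave nine membership
     patterns, each a linear inequality between [theta k] and the two increments. *)
  rewrite /H -big_split/=; apply: ler_sum => k _.
  have := thetaB k x Dx; have := thetaB k x' Dx'.
  have : inc k (f0 x') <= inc k (f0 x) by apply/inc_le/f0_mono => //; exact: ltW.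
  have : (x' \in A k) ==> (x \in A k).
    by apply/implyP; rewrite !inA// => /lt_le_trans; apply.
  have : (x \in B k) ==> (x' \in B k).
    by apply/implyP; rewrite !inB// => /lt_trans; apply.
  rewrite /ind; case: (x \in A k); case: (x' \in A k) => //=;
    case: (x \in B k); case: (x' \in B k) => //= _ _ ? ? ?; lra.
have mind (E : set R) : measurable E -> measurable_fun D (ind E).
  by move=> mE; exact: measurable_indic.
have iphi (g : R -> R) : measurable_fun D g -> (forall x, D x -> m <= g x <= M) ->
    mu.-integrable D (EFin \o (fun x => phi (g x - f0 x))).
  move=> mg gM; apply: (@convex_comp_integrable _ _ _ mu D phi (g \- f0) (M - m)) => //.
    exact: measurable_funB.
  move=> x Dx /=; have /andP[? ?] := gM x Dx; have /andP[? ?] := f0_itv Dx.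
  by rewrite ler_norml; apply/andP; split; lra.
have iinc k : mu.-integrable D (EFin \o (fun x => inc k (f0 x))).
  have ik l : mu.-integrable D (EFin \o (fun x => phi (y l - f0 x))).
    apply: (@convex_comp_integrable _ _ _ mu D phi (cst (y l) \- f0)
      (`|y l| + `|m| + `|M|)) => //.
      exact: measurable_funB.
    move=> x Dx /=; have /andP[? ?] := f0_itv Dx.
    have f0B : `|f0 x| <= `|m| + `|M|.
      have := ler_norm M; have := ler_norm (- m); rewrite normrN => ? ?.
      have := normr_ge0 M; have := normr_ge0 m => ? ?.
      by rewrite ler_norml; apply/andP; split; lra.
    by have := ler_normB (y l) (f0 x); lra.
  exact (integrableB mD (ik k.+1) (ik k)).
have icst (c : R) : mu.-integrable D (EFin \o cst c).
  by apply: (@bounded_integrable _ _ _ _ _ _ `|c|).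
have iAB k : mu.-integrable D (EFin \o (fun x => ind (A k) x - ind (B k) x)).
  apply: (@bounded_integrable _ _ _ _ _ _ 1) => //.
    by apply: measurable_funB; apply: mind.
  move=> x _; rewrite /ind; case: (x \in A k); case: (x \in B k) => /=;
    by rewrite ler_norml; apply/andP; split; lra.
have iH : mu.-integrable D (EFin \o H).
  pose e (k : nat) x := (ind (A k) x - ind (B k) x) * (inc k (f0 x) - theta k).
  apply: (proj1 (@Rintegral_sum _ _ _ mu D e N mD _)) => k.
  apply: (@integrableMr _ _ _ mu D mD (fun x => ind (A k) x - ind (B k) x)
    (EFin \o (fun x => inc k (f0 x) - theta k))).
  - by apply: measurable_funB; apply: mind.
  - exists 1; split; first exact: num_real.
    move=> z z1 x _; apply: le_trans (ltW z1); rewrite /ind.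
    by case: (x \in A k); case: (x \in B k) => /=;
      rewrite ler_norml; apply/andP; split; lra.
  - exact (integrableB mD (iinc k) (icst (theta k))).
have [iW EW] : mu.-integrable D (EFin \o W) /\ \int[mu]_(x in D) W x =
     \sum_(k < N) \int[mu]_(x in D) (theta k * (ind (A k) x - ind (B k) x)).
  pose e (k : nat) x := theta k * (ind (A k) x - ind (B k) x).
  apply: (@Rintegral_sum _ _ _ mu D e N mD _) => k.
  exact (integrableZl mD (theta k) (iAB k)).
(* Each term is a constant times the difference of the measures of [A k] and [B k]. *)
have {}EW : \int[mu]_(x in D) W x = 0.
  rewrite EW big1// => k _; rewrite RintegralZl//.
  have iind (E : set R) : measurable E -> mu.-integrable D (EFin \o ind E).
    move=> mE; apply: (@bounded_integrable _ _ _ _ _ _ 1) => //; first exact: mind.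
    by move=> x _; rewrite /ind; case: (x \in E); rewrite ?normr1 ?normr0.
  have Eind (E : set R) : measurable E -> \int[mu]_(x in D) ind E x = fine (mu (E `&` D)).
    by move=> mE; rewrite /Rintegral; congr fine; exact: integral_indic.
  rewrite RintegralB//; [|exact: iind..].
  rewrite !Eind//.
  by rewrite setIAC setIid -[_ `&` [set _ | _]]/(A k) muAB// subrr mulr0.
have iFG : mu.-integrable D (EFin \o (fun x => phi (F x - f0 x) - phi (G x - f0 x))).
  exact (integrableB mD (iphi F F_meas F_itv) (iphi G G_meas G_itv)).
have iLW : mu.-integrable D (EFin \o (fun x => 2 * (L * h) - W x)).
  exact (integrableB mD (icst (2 * (L * h))) iW).
apply: (@le_trans _ _ (\int[mu]_(x in D) H x)).
  apply: (@Rintegral_ge_pair _ _ _ mu D X0 X0') => //.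
  apply/seteqP; split => // x [Xx Xx'].
  by have [] := HX x x Xx Xx'; rewrite ltxx.
apply: (@le_trans _ _ (\int[mu]_(x in D)
    ((phi (F x - f0 x) - phi (G x - f0 x)) + (2 * (L * h) - W x)))).
  apply: le_Rintegral => //.
  exact (integrableD mD iFG iLW).
rewrite RintegralD// RintegralB//; [|exact: iphi..].
rewrite (@RintegralB _ _ _ _ _ (cst _))// EW subr0 Rintegral_cst//.
by rewrite lerD2l -[fine _]/(fine (mu D)) muD.
Qed.

(** The rounding errors are of order [1 / N], so a positive deficit [e] is contradicted by a fine
    enough grid. *)
Lemma quantile_gain (X0 X0' : set R) (delta eta : R) :
  measurable X0 -> measurable X0' -> X0 `<=` D -> X0' `<=` D ->
  (forall x x', X0 x -> X0' x' -> [/\ x < x', F x' <= F x &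
    eta <= phi (F x - f0 x) - phi (F x - f0 x') - phi (F x' - f0 x)
           + phi (F x' - f0 x')]) ->
  0 <= delta -> (delta%:E <= mu X0)%E -> (delta%:E <= mu X0')%E ->
  \int[mu]_(x in D) phi (G x - f0 x) + delta * eta
    <= \int[mu]_(x in D) phi (F x - f0 x).
Proof.
move=> mX mX' XD XD' HX d0 dX dX'.
have [L L0 HL] := convex_fun_lipschitz (M - m) cphi phi0.
set IG := (X in X + _ <= _); set IF := (X in _ <= X).
rewrite leNgt; apply/negP; rewrite -subr_gt0; set e := _ - _ => e0.
(* [C / N] is the total rounding error in [discretized_gain]. *)
pose C := L * (M - m) * (4 * delta + 2 * (b - a)).
have Mm0 : 0 <= M - m by rewrite subr_ge0 ltW.
have ba0 : 0 <= b - a by rewrite subr_ge0 ltW.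
have C0 : 0 <= C by rewrite !mulr_ge0// addr_ge0// mulr_ge0.
pose N := (Num.truncn (C / e)).+1.
have CN : C / N%:R < e.
  by rewrite ltr_pdivrMr ?ltr0n// mulrC -ltr_pdivrMr// truncnS_gt.
have := @discretized_gain L N X0 X0' delta eta isT L0 HL mX mX' XD XD' HX d0 dX dX'.
rewrite -/IF -/IG.
have -> : L * ((M - m) / N%:R) = L * (M - m) / N%:R by rewrite mulrA.
have : C / N%:R = 4 * delta * (L * (M - m) / N%:R)
                  + 2 * (L * (M - m) / N%:R) * (b - a) by rewrite /C; ring.
have : e = IG + delta * eta - IF by [].
by move: CN; lra.
Qed.

End discretized.

(** * The rearrangement as a quantile function *)

(** The pushforward of Lebesgue measure under [a + c * u], scaled by [c], gives half-open intervals
    their length, and this determines Lebesgue measure. *)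
Lemma lebesgue_measure_affine (R : realType) (a c : R) (A : set R) :
  0 < c -> measurable A ->
  lebesgue_measure A =
    (c%:E * lebesgue_measure ((fun u : R => (a + c * u)%R) @^-1` A))%E.
Proof.
move=> c0 mA.
have mg : measurable_fun [set: measurableTypeR R]
    ((fun u : R => a + c * u) : measurableTypeR R -> measurableTypeR R).
  by apply: measurable_funD => //; exact: measurable_funM.
pose g : {mfun measurableTypeR R >-> measurableTypeR R} :=
  @mfun_Sub _ _ (measurableTypeR R) (measurableTypeR R) _ (mem_set mg).
pose r : {nonneg R} := NngNum (ltW c0).
apply: (@lebesgue_measure_unique R (mscale r (pushforward lebesgue_measure g))) => //.
move=> _ [[x y]] _ <-.
rewrite -[RHS]/(c%:E * lebesgue_measure (g @^-1` `]x, y]%classic))%E.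
have -> : g @^-1` `]x, y]%classic =
    `](x - a) / c, (y - a) / c]%classic.
  apply/seteqP; split=> u /=; rewrite !in_itv/= ltr_pdivrMr// ler_pdivlMr//;
    by rewrite ltrBlDl lerBrDl mulrC.
rewrite !lebesgue_measure_itv/= !lte_fin ltr_pM2r ?invr_gt0// ltrD2r.
case: ifP => _; last by rewrite mule0.
by rewrite -!EFinB -EFinM; congr EFin; field; rewrite gt_eqF.
Qed.

Lemma cdf01_affine (R : realType) (a b y : R) (F : R -> R) :
  a < b -> measurable_fun `[a, b]%classic F ->
  ((b - a)%:E * cdf01 (fun u => F (a + (b - a) * u)%R) y)%E =
  lebesgue_measure (`[a, b]%classic `&` [set x | F x <= y]).
Proof.
move=> ab mF; have c0 : 0 < b - a by rewrite subr_gt0.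
have mE : measurable (`[a, b]%classic `&` [set x | F x <= y]).
  rewrite (_ : [set x | F x <= y] = F @^-1` `]-oo, y]%classic).
    by apply: mF => //; exact: measurable_itv.
  by apply/seteqP; split=> x /=; rewrite in_itv/=.
rewrite (@lebesgue_measure_affine R a _ _ c0 mE); congr (_ * _)%E.
set g := fun u : R => a + (b - a) * u.
have g01 u : `[0, 1]%classic u <-> `[a, b]%classic (g u).
  rewrite /g /= !in_itv/=; split=> /andP[u0 u1]; apply/andP; split.
  - by rewrite lerDl mulr_ge0// ltW.
  - by rewrite -lerBrDl ger_pMr.
  - by move: u0; rewrite lerDl pmulr_rge0.
  - by move: u1; rewrite -lerBrDl ger_pMr.
have mg : measurable_fun [set: R] g.
  by apply: measurable_funD => //; exact: measurable_funM.
have mgE : measurable (g @^-1` (`[a, b]%classic `&` [set x | F x <= y])).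
  by rewrite -[X in measurable X]setTI; exact: mg.
rewrite /cdf01.
transitivity (\int[@lebesgue_measure R]_(u in `[0%R, 1%R])
   (\1_(g @^-1` (`[a, b]%classic `&` [set x | F x <= y])) u)%:E)%E.
  apply: eq_integral => u; rewrite inE => /g01 gu; congr (_%:E).
  rewrite !indicE; congr (_%:R); congr nat_of_bool.
  apply/idP/idP; rewrite !inE/=; [by split|by case].
rewrite integral_indic//; congr (lebesgue_measure _).
by apply/setIidPl => u /= [/g01].
Qed.

(** Supplies the hypotheses of the grid argument. The rearrangement is [-oo] at [a], so it agrees
    with the real function [G] on []a, b]] only. *)
Lemma rearr_quantile (R : realType) (a b m M : R) (F : R -> R) :
  a < b -> m < M -> measurable_fun `[a, b]%classic F ->
  (forall x, `[a, b]%classic x -> m <= F x <= M) ->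
  exists G s : R -> R,
    [/\ measurable_fun `[a, b]%classic G /\
        (forall x, `[a, b]%classic x -> m <= G x <= M),
        (forall y, `[a, b]%classic (s y)),
        (forall y, lebesgue_measure (`[a, b]%classic `&` [set x | F x <= y]) =
          (s y - a)%:E),
        (forall x y, `[a, b]%classic x -> m <= y <= M ->
          (G x < y -> x <= s y) /\ (x <= s y -> G x <= y)) &
        forall x, `]a, b]%classic x -> rearr a b F x = (G x)%:E].
Proof.
move=> ab mM mF FmM.
set D : set R := `[a, b]%classic.
have muD : lebesgue_measure D = (b - a)%:E.
  by rewrite lebesgue_measure_itv/= lte_fin ab.
have mE y : measurable (D `&` [set x | F x <= y]).
  rewrite (_ : [set x | F x <= y] = F @^-1` `]-oo, y]%classic).
    by apply: mF => //; exact: measurable_itv.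
  by apply/seteqP; split=> x /=; rewrite in_itv/=.
have Ele y : (lebesgue_measure (D `&` [set x | F x <= y]%R) <= (b - a)%:E)%E.
  rewrite -muD; apply: le_measure; [exact: (mem_set (mE _))| |exact: subIsetl].
  by apply/mem_set; exact: measurable_itv.
pose s y := a + fine (lebesgue_measure (D `&` [set x | F x <= y])).
have Efin y : lebesgue_measure (D `&` [set x | F x <= y]) = (s y - a)%:E.
  rewrite /s addrC addKr fineK// ge0_fin_numE//.
  by rewrite (le_lt_trans (Ele y))// ltry.
have sab y : a <= s y <= b.
  rewrite /s lerDl fine_ge0//= -lerBrDl -lee_fin fineK ?Ele//.
  by rewrite Efin.
have s_mono y y' : y <= y' -> s y <= s y'.
  move=> yy'; rewrite -(lerD2r (- a)) -lee_fin -!Efin.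
  apply: le_measure; [exact: (mem_set (mE _))|exact: (mem_set (mE _))|].
  by apply: setIS => x /= /le_trans; apply.
have s_low y : y < m -> s y = a.
  move=> ym; rewrite /s (_ : _ `&` _ = set0) ?measure0/= ?addr0//.
  apply/seteqP; split=> // x /= [Dx]; have /andP[mx _] := FmM x Dx.
  by rewrite leNgt (lt_le_trans ym).
have sM : s M = b.
  rewrite /s (_ : _ `&` _ = D) ?muD/=; first by rewrite subrKC.
  by apply/setIidPl => x /FmM /andP[].
(* The bound [m <= y] keeps the set bounded below and capping [x] at [b] keeps it nonempty, so [G]
   is monotone on the whole line. For [a < x <= b] the set is unchanged, as [s y = a] for
   [y < m]. *)
pose Y x := [set y | m <= y /\ Num.min x b <= s y].
have Ylb x : has_lbound (Y x) by exists m => y [].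
have YM x : Y x M by split; [exact: ltW|rewrite sM ge_min lexx orbT].
have Yne x : Y x !=set0 by exists M.
pose G x := inf (Y x).
have G_le x y : Y x y -> G x <= y by move=> Yy; exact: ge_inf.
exists G, s; split=> //.
- split.
    apply: nondecreasing_measurable; [exact: measurable_itv|move=> x x' xx'].
    apply: lb_le_inf => // y [my xy]; apply: G_le; split=> //.
    by rewrite (le_trans _ xy)// le_min !ge_min lexx xx' /= orbT.
  move=> x _; apply/andP; split; last exact: G_le.
  by apply: lb_le_inf => // y [].
- move=> x y; rewrite /D/= in_itv/= => /andP[ax xb] /andP[my yM].
  have minx : Num.min x b = x by apply/min_idPl.
  split; last by move=> xs; apply: G_le; split; rewrite ?minx.
  move=> /(inf_lt (Yne x))[z [mz]].
  by rewrite minx => xz /ltW/s_mono; exact: le_trans.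
move=> x /=; rewrite in_itv/= => /andP[ax xb].
have minx : Num.min x b = x by apply/min_idPl.
rewrite /rearr /rearr01 -ereal_inf_EFin//; congr ereal_inf.
congr image; apply/seteqP; split=> y /=.
  rewrite -(@lee_pmul2l _ (b - a)%:E)// ?lte_fin ?subr_gt0//.
  rewrite cdf01_affine// Efin -EFinM lee_fin.
  rewrite mulrCA divff ?gt_eqF ?subr_gt0// mulr1 lerD2r => xs.
  split; last by rewrite minx.
  by rewrite leNgt; apply/negP => /s_low sy; move: xs; rewrite sy leNgt ax.
move=> [my]; rewrite minx => xs.
rewrite -(@lee_pmul2l _ (b - a)%:E)// ?lte_fin ?subr_gt0//.
rewrite cdf01_affine// Efin -EFinM lee_fin.
by rewrite mulrCA divff ?gt_eqF ?subr_gt0// mulr1 lerD2r.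
Qed.

(** * Norms and gains *)

(** The extension by zero outside [[a, b]] adds nothing, since [0] to a positive power is [0]. *)
Lemma Lp_norm_int_pow (R : realType) (a b p : R) (g : R -> \bar R) :
  0 < p -> Lp_norm a b p%:E g = (int_pow a b p g `^ p^-1)%E.
Proof.
move=> p0; rewrite /Lp_norm unlock /int_pow; congr poweR.
rewrite [RHS]integral_mkcond; apply: eq_integral => x _.
by rewrite /patch; case: ifP => // _; rewrite abse0 poweR0r// gt_eqF.
Qed.

Lemma int_pow_EFin (R : realType) (a b p B : R) (g : R -> R) :
  1 <= p -> measurable_fun `[a, b]%classic g ->
  (forall x, `[a, b]%classic x -> `|g x| <= B) ->
  int_pow a b p (fun x => (g x)%:E) =
  (\int[lebesgue_measure]_(x in `[a, b]%classic) (`|g x| `^ p))%:E.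
Proof.
move=> p1 mg gB; rewrite /int_pow /Rintegral fineK//.
apply: integrable_fin_num; first exact: measurable_itv.
apply: (@convex_comp_integrable _ _ _ lebesgue_measure `[a, b]%classic
  (fun s : R => `|s| `^ p) g B) => //.
- exact: convex_fun_norm_powR.
- by have /= -> := lebesgue_measure_itv `[a, b]; case: ifP => _;
    rewrite ?ltry// -EFinB ltry.
Qed.

(* The rearrangement takes the value -oo at the left endpoint a. *)
Lemma int_pow_itv_oc (R : realType) (a b p : R) (f : R -> \bar R) (g : R -> R) :
  measurable_fun `[a, b]%classic g ->
  (forall x, `]a, b]%classic x -> f x = (g x)%:E) ->
  int_pow a b p f = int_pow a b p (fun x => (g x)%:E).
Proof.
move=> mg fg; rewrite /int_pow.
have mgp : measurable_fun `]a, b]%classic (fun x => `|(g x)%:E| `^ p)%E.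
  apply/measurable_EFinP; apply: (@measurableT_comp _ _ _ _ _ _ (@powR R ^~ p)).
    exact: measurable_powR.
  apply: measurableT_comp => //; apply: measurable_funS mg => //.
  exact: subset_itv_oc_cc.
have E x : x \in `]a, b]%classic -> (`|f x| `^ p = `|(g x)%:E| `^ p)%E.
  by rewrite inE => /fg ->.
rewrite -[LHS]integral_itv_obnd_cbnd; last first.
  by apply: eq_measurable_fun mgp => x /E.
rewrite -[RHS]integral_itv_obnd_cbnd//.
exact: eq_integral.
Qed.

(** The essential supremum runs over the whole line; outside [[a, b]] the extension is zero, which
    is at most [E] as [0 <= E]. *)
Lemma Lp_norm_pinfty_le (R : realType) (a b : R) (g : R -> \bar R) (E : \bar R) :
  (0 <= E)%E ->
  (Lp_norm a b +oo g <= E)%E <->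
  {ae (@lebesgue_measure R), forall x, `[a, b]%classic x -> (`|g x| <= E)%E}.
Proof.
move=> E0; rewrite /Lp_norm unlock /=.
(* The norm at [+oo] is defined by cases on whether the whole space has positive measure. *)
have -> : (0 < @lebesgue_measure R [set: R])%E.
  apply: (@lt_le_trans _ _ (@lebesgue_measure R `[0, 1]%classic)).
    by rewrite lebesgue_measure_itv/= lte_fin ltr01 oppr0 adde0 lte_fin ltr01.
  by apply: le_measure => //; apply/mem_set => //; exact: measurable_itv.
split.
  move=> /ess_supP; apply: (@filterS _ _ (ae_filter_ringOfSetsType (@lebesgue_measure R))).
  move=> x /=; rewrite /patch.
  by case: ifPn => [xD + _//|xD _ Dx]; rewrite mem_set in xD.
move=> H; apply/ess_supP; move: H.
apply: (@filterS _ _ (ae_filter_ringOfSetsType (@lebesgue_measure R))) => x /= H.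
rewrite /patch; case: ifPn => [|_]; first by rewrite inE => /H.
by rewrite abse0.
Qed.

(** By [convex_fun_increment] every cross difference is nonnegative, so the real infimum is over a
    set bounded below by 0. *)
Lemma eta_gain_le (R : realType) (K : set R) (eps p v v' t t' : R) :
  1 <= p -> 0 <= eps -> K v -> K v' -> K t -> K t' ->
  v + eps <= v' -> t + eps <= t' ->
  0 <= eta_gain K eps p /\
  eta_gain K eps p <= `|v - t'| `^ p + `|v' - t| `^ p - `|v - t| `^ p - `|v' - t'| `^ p.
Proof.
move=> p1 eps0 Kv Kv' Kt Kt' vv' tt'; rewrite /eta_gain; set S := [set z | _].
have S0 : lbound S 0.
  move=> _ [w [w' [u [u' [_ [ww' [uu' ->]]]]]]].
  have := @convex_fun_increment _ _ (w - u') (w - u) (w' - w)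
    (convex_fun_norm_powR p1).
  have -> : w - u' + (w' - w) = w' - u' by ring.
  have -> : w - u + (w' - w) = w' - u by ring.
  by move=> /(_ ltac:(lra) ltac:(lra)); lra.
have Sz : S (`|v - t'| `^ p + `|v' - t| `^ p - `|v - t| `^ p - `|v' - t'| `^ p).
  by exists v, v', t, t'.
split; first by apply: lb_le_inf => //; eexists; exact: Sz.
by apply: ge_inf Sz; exists 0.
Qed.

(** A cross difference of a convex function grows with both gaps. Shrinking [w' - w] and [u' - u] to
    [eps] leaves a second difference with step [eps] at [w - u'], bounded below by
    [norm_powR_gap]. *)
Lemma eta_gain_gt0 (R : realType) (K : set R) (eps p B : R) :
  1 < p -> 0 < eps -> (forall x y, K x -> K y -> `|x - y| <= B) ->
  (exists v v' t t', [/\ K v, K v', K t & K t'] /\ v + eps <= v' /\ t + eps <= t') ->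
  0 < eta_gain K eps p.
Proof.
move=> p1 eps0 KB [v [v' [t [t' [[Kv Kv' Kt Kt'] [vv' tt']]]]]].
have B0 : 0 <= B by rewrite (le_trans _ (KB v v Kv Kv)).
have [g g0 Hg] := norm_powR_gap p1 eps0 B0.
apply: (lt_le_trans g0); apply: lb_le_inf.
  by eexists; exists v, v', t, t'.
move=> _ [w [w' [u [u' [[Kw Kw' Ku Ku'] [ww' [uu' ->]]]]]]].
have cphi := convex_fun_norm_powR (ltW p1).
apply: (le_trans (Hg (w - u') (KB _ _ Kw Ku'))).
have := @convex_fun_increment _ _ (w - u' + eps) (w - u) (w' - w) cphi.
have := @convex_fun_increment _ _ (w - u' + eps) (w - u' + (w' - w)) eps cphi.
have -> : w - u' + (w' - w) = w' - u' by ring.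
have -> : w - u + (w' - w) = w' - u by ring.
have -> : w - u' + eps + eps = w - u' + 2 * eps by ring.
have -> : w - u' + eps + (w' - w) = w' - u' + eps by ring.
move=> /(_ ltac:(lra) ltac:(lra)) + /(_ ltac:(lra) ltac:(lra)); lra.
Qed.

(** * Weak error reduction for convex costs and for the essential supremum *)

Section rearrangement_error.
Variables (R : realType) (a b m M : R) (F G f0 s : R -> R).
Local Notation D := (`[a, b]%classic : set R).
Local Notation mu := (@lebesgue_measure R).
Hypothesis hab : a < b.
Hypothesis hmM : m < M.
Hypothesis F_meas : measurable_fun D F.
Hypothesis G_meas : measurable_fun D G.
Hypothesis f0_meas : measurable_fun D f0.
Hypothesis F_itv : forall x, D x -> m <= F x <= M.
Hypothesis G_itv : forall x, D x -> m <= G x <= M.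
Hypothesis f0_itv : forall x, D x -> m <= f0 x <= M.
Hypothesis f0_mono : forall x y, D x -> D y -> x <= y -> f0 x <= f0 y.
Hypothesis s_itv : forall y, D (s y).
Hypothesis s_cdf : forall y, m <= y <= M ->
  mu (D `&` [set x | F x <= y]) = (s y - a)%:E.
Hypothesis G_s : forall x y, D x -> m <= y <= M ->
  (G x < y -> x <= s y) /\ (x <= s y -> G x <= y).

Lemma quantile_le (phi : R -> R) :
  convex_fun phi -> (forall u, 0 <= phi u) ->
  \int[mu]_(x in D) phi (G x - f0 x) <= \int[mu]_(x in D) phi (F x - f0 x).
Proof.
move=> cphi phi0.
(* Empty regions with [delta = 0] and [eta = 0] reduce the gain to the weak inequality. *)
have := @quantile_gain R a b m M phi F G f0 s hab hmM cphi phi0 F_meas G_meas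
  f0_meas F_itv G_itv f0_itv f0_mono s_itv s_cdf G_s set0 set0 0 0.
rewrite mul0r addr0 measure0; apply => //.
Qed.

(** With [E] the norm of the initial error, the dead-zone cost of [F] has integral zero. By
    [quantile_le] so has that of [G], which bounds the new error by [E] almost everywhere. *)
Lemma Lp_norm_pinfty_quantile_le :
  (Lp_norm a b +oo (fun x => (G x - f0 x)%:E) <=
   Lp_norm a b +oo (fun x => (F x - f0 x)%:E))%E.
Proof.
set e := (X in (_ <= X)%E).
have e0 : (0 <= e)%E by exact: Lnorm_ge0.
have eM : (e <= (M - m)%:E)%E.
  apply/Lp_norm_pinfty_le; first by rewrite lee_fin subr_ge0 ltW.
  apply/aeW => x Dx; rewrite lee_fin ler_norml.
  have /andP[? ?] := F_itv Dx; have /andP[? ?] := f0_itv Dx.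
  by apply/andP; split; lra.
have efin : e \is a fin_num by rewrite ge0_fin_numE// (le_lt_trans eM)// ltry.
have := lexx e; rewrite {1}/e Lp_norm_pinfty_le// => aeF.
rewrite -(fineK efin) in aeF e0 *; set E := fine e in aeF e0 *.
pose phi (u : R) := Num.max (`|u| - E) 0.
have cphi : convex_fun phi by exact: convex_fun_dead_zone.
have phi0 u : 0 <= phi u by rewrite le_max lexx orbT.
have Doo : (mu D < +oo)%E by rewrite lebesgue_measure_itv/= lte_fin hab ltry.
have iphi (g : R -> R) : measurable_fun D g -> (forall x, D x -> m <= g x <= M) ->
    mu.-integrable D (EFin \o (fun x => phi (g x - f0 x))).
  move=> mg gM; apply: (@convex_comp_integrable _ _ _ mu D phi (g \- f0) (M - m)) => //.
    exact: measurable_funB.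
  move=> x Dx /=; have /andP[? ?] := gM x Dx; have /andP[? ?] := f0_itv Dx.
  by rewrite ler_norml; apply/andP; split; lra.
have mphi (g : R -> R) : measurable_fun D g -> (forall x, D x -> m <= g x <= M) ->
    measurable_fun D (EFin \o (fun x => phi (g x - f0 x))).
  by move=> mg gM; exact: measurable_int (iphi g mg gM).
have absE (g : R -> R) :
    (\int[mu]_(x in D) `|(phi (g x - f0 x))%:E| =
     \int[mu]_(x in D) (phi (g x - f0 x))%:E)%E.
  by apply: eq_integral => x _; rewrite gee0_abs// lee_fin.
have mD : measurable (D : set (measurableTypeR R)) by [].
have F0 : \int[mu]_(x in D) phi (F x - f0 x) = 0.
  rewrite /Rintegral -absE (_ : (\int[mu]_(x in D) _)%E = 0%E)//.
  apply/(ae_eq_integral_abs mu mD (mphi F F_meas F_itv)).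
  move: aeF; apply: (@filterS _ _ (ae_filter_ringOfSetsType (@lebesgue_measure R))).
  move=> x H Dx /=; congr EFin.
  by apply/max_idPr; rewrite subr_le0 -lee_fin; exact: H.
have G0 : \int[mu]_(x in D) phi (G x - f0 x) = 0.
  apply/eqP; rewrite eq_le -{1}F0 quantile_le//=.
  by apply: Rintegral_ge0.
apply/Lp_norm_pinfty_le => //.
have : (\int[mu]_(x in D) `|(phi (G x - f0 x))%:E| = 0)%E.
  rewrite absE -[LHS]fineK; first by rewrite -[fine _]/(Rintegral _ _ _) G0.
  exact: integrable_fin_num (iphi G G_meas G_itv).
move=> /(ae_eq_integral_abs mu mD (mphi G G_meas G_itv)).
apply: (@filterS _ _ (ae_filter_ringOfSetsType (@lebesgue_measure R))) => x H Dx.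
have [] := H Dx => /eqP.
by rewrite lee_fin -subr_le0 => /eqP <-; rewrite le_max lexx.
Qed.

End rearrangement_error.

(** * Error reduction and gain for the rearrangement *)

Local Open Scope ereal_scope.
Theorem proposition1 (R : realType) (a b : R) (K : set R) (f0 fhat : R -> R)
    (hab : (a < b)%R)
    (K_bounded : has_ubound K /\ has_lbound K)
    (f0_K : forall x, x \in `[a, b] -> K (f0 x))
    (f0_mono : forall x y, x \in `[a, b] -> y \in `[a, b] ->
       (x <= y)%R -> (f0 x <= f0 y)%R)
    (f0_meas : measurable_fun `[a, b]%classic f0)
    (fhat_K : forall x, x \in `[a, b] -> K (fhat x))
    (fhat_meas : measurable_fun `[a, b]%classic fhat) :
  let err := fun x : R => (fhat x - f0 x)%:E in
  let err_star := fun x : R => rearr a b fhat x - (f0 x)%:E in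
  (forall p : \bar R, 1 <= p ->
     Lp_norm a b p err_star <= Lp_norm a b p err)
  /\
  (forall (X0 X0' : set R) (delta eps : R),
     measurable X0 -> measurable X0' ->
     X0 `<=` `[a, b] -> X0' `<=` `[a, b] ->
     (0 < delta)%R -> (0 < eps)%R ->
     delta%:E < lebesgue_measure X0 -> delta%:E < lebesgue_measure X0' ->
     (forall x x', X0 x -> X0' x' ->
        [/\ (x < x')%R, (fhat x' + eps < fhat x)%R & (f0 x + eps < f0 x')%R]) ->
     let deltaX := (delta / (b - a))%R in
     (forall p : R, (1 < p)%R ->
        (0 < eta_gain K eps p)%R /\
        Lp_norm a b p%:E err_star < Lp_norm a b p%:E err)
     /\
     (forall p : R, (1 <= p)%R ->
        (* with respect to the normalized measure dx / (b - a) on [a, b] *)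
        (0 <= avg_pow a b p err - (deltaX * eta_gain K eps p)%:E /\
         avg_pow a b p err_star `^ p^-1 <=
           (avg_pow a b p err - (deltaX * eta_gain K eps p)%:E) `^ p^-1)
        /\
        (* with respect to dx; this requires an interval of length >= 1 *)
        ((1 <= b - a)%R ->
         0 <= int_pow a b p err - (deltaX * eta_gain K eps p)%:E /\
         int_pow a b p err_star `^ p^-1 <=
           (int_pow a b p err - (deltaX * eta_gain K eps p)%:E) `^ p^-1))
     /\
     Lp_norm a b +oo err_star <= Lp_norm a b +oo err).
Proof.
move=> err err_star.
set D : set R := `[a, b]%classic.
have [m [M [mM Km]]] : exists m M, (m < M)%R /\ forall z, K z -> (m <= z <= M)%R.
  move: K_bounded => [[u uK] [l lK]].
  have Ka : K (f0 a) by apply: f0_K; rewrite in_itv/= lexx ltW.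
  (* The added 1 makes [m < M] even when [K] is a single point. *)
  exists l, (u + 1)%R; split.
    by have := uK _ Ka; have := lK _ Ka; lra.
  by move=> z Kz; have := uK _ Kz; have := lK _ Kz => ? ?; apply/andP; split; lra.
have F_itv x : D x -> (m <= fhat x <= M)%R by move=> Dx; apply/Km/fhat_K.
have f0_itv x : D x -> (m <= f0 x <= M)%R by move=> Dx; apply/Km/f0_K.
have [G [s [[G_meas G_itv] s_itv s_cdf G_s GE]]] :=
  rearr_quantile hab mM fhat_meas F_itv.
have starE x : `]a, b]%classic x -> err_star x = (G x - f0 x)%:E.
  by move=> /GE; rewrite /err_star => ->.
have FG_meas (g : R -> R) : measurable_fun D g ->
    measurable_fun D (fun x => (g x - f0 x)%R).
  by move=> mg; exact: measurable_funB.
have FG_bd (g : R -> R) : (forall x, D x -> (m <= g x <= M)%R) ->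
    forall x, D x -> (`|g x - f0 x| <= M - m)%R.
  move=> gM x Dx; have /andP[? ?] := gM x Dx; have /andP[? ?] := f0_itv x Dx.
  by rewrite ler_norml; apply/andP; split; lra.
pose J (p : R) (g : R -> R) :=
  Rintegral (@lebesgue_measure R) D (fun x => (`|g x - f0 x| `^ p)%R).
have J0 p g : (0 <= J p g)%R by apply: Rintegral_ge0 => x _; exact: powR_ge0.
have errE (p : R) : (1 <= p)%R -> int_pow a b p err = (J p fhat)%:E.
  move=> p1; apply: (@int_pow_EFin _ _ _ _ (M - m)) => //.
    exact: FG_meas.
  exact: FG_bd.
have err_starE (p : R) : (1 <= p)%R -> int_pow a b p err_star = (J p G)%:E.
  move=> p1; rewrite (@int_pow_itv_oc _ _ _ _ _ (fun x => (G x - f0 x)%R))//;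
    last exact: FG_meas.
  by apply: (@int_pow_EFin _ _ _ _ (M - m)) => //; [exact: FG_meas|exact: FG_bd].
have pinfty_le : Lp_norm a b +oo err_star <= Lp_norm a b +oo err.
  apply: le_trans (@Lp_norm_pinfty_quantile_le R a b m M fhat G f0 s hab mM
    fhat_meas G_meas f0_meas F_itv G_itv f0_itv f0_mono s_itv (fun y _ => s_cdf y) G_s).
  apply/Lp_norm_pinfty_le; first exact: Lnorm_ge0.
  have /Lp_norm_pinfty_le aeG : Lp_norm a b +oo (fun x => (G x - f0 x)%:E) <=
    Lp_norm a b +oo (fun x => (G x - f0 x)%:E) by [].
  have {}aeG := aeG (Lnorm_ge0 _ _ _).
  (* The endpoint [a], where the rearrangement is [-oo], is a null set. *)
  have aea : {ae (@lebesgue_measure R), forall x, x <> a}.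
    exists [set a]; split => //; first exact: lebesgue_measure_set1.
    by move=> x /= /contrapT.
  apply: (@filterS2 _ _ (ae_filter_ringOfSetsType (@lebesgue_measure R)) _ _ _ _ aea aeG).
  move=> x xa H Dx; rewrite starE; first exact: H.
  move: Dx; rewrite /= !in_itv/= => /andP[ax ->].
  by rewrite andbT lt_neqAle ax andbT; apply/eqP => ?; apply: xa.
(* Keeps unification from comparing err with err_star by unfolding rearr. *)
clearbody err err_star.
have powR_J_le (p x y : R) : (1 <= p)%R -> (0 <= x)%R -> (x <= y)%R ->
    (x `^ p^-1 <= y `^ p^-1)%R.
  move=> p1 x0 xy; apply: ge0_ler_powR; rewrite ?nnegrE ?invr_ge0//; lra.
split.
  move=> [p| |]; rewrite ?leNye_eq ?leeNy_eq // lee_fin => p1.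
  rewrite !Lp_norm_int_pow; [|lra..].
  rewrite (errE p p1) (err_starE p p1) lee_fin.
  apply: (powR_J_le p _ _ p1 (J0 p G)).
  apply: (@quantile_le R a b m M fhat G f0 s hab mM fhat_meas G_meas f0_meas
    F_itv G_itv f0_itv f0_mono s_itv (fun y _ => s_cdf y) G_s
    (fun u => (`|u| `^ p)%R)); first exact: convex_fun_norm_powR.
  by move=> u; exact: powR_ge0.
move=> X0 X0' delta eps mX mX' XD XD' d0 eps0 dX dX' HX deltaX.
have ne (Y : set R) : delta%:E < lebesgue_measure Y -> Y !=set0.
  move=> dY; apply/set0P; apply: contraTneq dY => ->.
  by rewrite measure0 -leNgt lee_fin ltW.
have [x1 X1] := ne X0 dX; have [x1' X1'] := ne X0' dX'.
have eta0 (p : R) : (1 <= p)%R -> (0 <= eta_gain K eps p)%R.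
  move=> p1; have [_ /ltW h1 /ltW h2] := HX x1 x1' X1 X1'.
  have Dx := XD _ X1; have Dx' := XD' _ X1'.
  by have [] := @eta_gain_le R K eps p (fhat x1') (fhat x1) (f0 x1) (f0 x1')
    p1 (ltW eps0) (fhat_K _ Dx') (fhat_K _ Dx) (f0_K _ Dx) (f0_K _ Dx') h1 h2.
(* The infimum is tested at [v = fhat x'], [v' = fhat x], [t = f0 x], [t' = f0 x']. With respect to
   [dx] the gain carries the factor [delta]. *)
have gain (p : R) : (1 <= p)%R -> (J p G + delta * eta_gain K eps p <= J p fhat)%R.
  move=> p1; apply: (@quantile_gain R a b m M (fun u => (`|u| `^ p)%R) fhat G f0 s
    hab mM _ _ fhat_meas G_meas f0_meas F_itv G_itv f0_itv f0_mono s_itv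
    (fun y _ => s_cdf y) G_s X0 X0') => //.
  - exact: convex_fun_norm_powR.
  - move=> x x' Xx Xx'; have [xx' h1 h2] := HX x x' Xx Xx'.
    split=> //; first by lra.
    have Dx := XD _ Xx; have Dx' := XD' _ Xx'.
    have [_] := @eta_gain_le R K eps p (fhat x') (fhat x) (f0 x) (f0 x')
      p1 (ltW eps0) (fhat_K _ Dx') (fhat_K _ Dx) (f0_K _ Dx) (f0_K _ Dx')
      (ltW h1) (ltW h2).
    lra.
  - exact: ltW.
  - exact: ltW.
  - exact: ltW.
split; last split=> //.
  move=> p p1; have etap : (0 < eta_gain K eps p)%R.
    apply: (@eta_gain_gt0 _ _ _ _ (M - m)) => //.
      move=> x y /Km/andP[? ?] /Km/andP[? ?].
      by rewrite ler_norml; apply/andP; split; lra.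
    have [_ /ltW h1 /ltW h2] := HX x1 x1' X1 X1'.
    exists (fhat x1'), (fhat x1), (f0 x1), (f0 x1').
    by split; [split; by [apply: fhat_K; exact: XD'|apply: fhat_K; exact: XD|
       apply: f0_K; exact: XD|apply: f0_K; exact: XD']|].
  split=> //.
  rewrite !Lp_norm_int_pow; [|lra..].
  rewrite (errE p (ltW p1)) (err_starE p (ltW p1)) lte_fin.
  apply: gt0_ltr_powR; rewrite ?nnegrE ?invr_gt0//; first lra.
  have := gain p (ltW p1).
  have : (0 < delta * eta_gain K eps p)%R by rewrite mulr_gt0.
  lra.
move=> p p1.
have ba0 : (0 < b - a)%R by lra.
have dX0 : (0 <= deltaX)%R by rewrite divr_ge0// ltW.
rewrite /avg_pow (errE p p1) (err_starE p p1) -!EFinM -!EFinB !lee_fin.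
have g1 := gain p p1.
have JG := J0 p G.
split.
  (* Dividing the gain inequality by [b - a] turns [delta] into [deltaX]. *)
  have H : ((b - a)^-1 * J p G <=
      (b - a)^-1 * J p fhat - deltaX * eta_gain K eps p)%R.
    rewrite lerBrDr (_ : _ + _ = (b - a)^-1 * (J p G + delta * eta_gain K eps p))%R.
      by rewrite ler_pM2l ?invr_gt0.
    by rewrite /deltaX; ring.
  have H0 : (0 <= (b - a)^-1 * J p G)%R by rewrite mulr_ge0// invr_ge0 ltW.
  by split; [exact: le_trans H|exact: (powR_J_le p _ _ p1)].
move=> ba1.
(* For [b - a >= 1] one has [deltaX <= delta], so the gain with factor [delta] implies this one. *)
have H : (J p G <= J p fhat - deltaX * eta_gain K eps p)%R.
  have : (deltaX * eta_gain K eps p <= delta * eta_gain K eps p)%R.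
    by rewrite ler_wpM2r ?eta0// ler_pdivrMr// ler_peMr// ltW.
  lra.
by split; [exact: le_trans H|exact: (powR_J_le p _ _ p1)].
Qed.
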